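(* Let $d_1,\dots,d_n$ be positive integers, let $\mathfrak d=\langle x_1^{d_1},\dots,x_n^{d_n}\rangle\subset R=\Bbbk[x_1,\dots,x_n]$, and consider $g=\beta_1x_1^{d_1}+\cdots+\beta_nx_n^{d_n}\in\mathfrak d$, where each $\beta_i\in\Bbbk^*$. If $p$ does not divide any $d_i$, then $\tau(g^t)=\mathfrak d^{[t]}$ for every real $0<t<1$.
   Context: $p$ is a prime, $\Bbbk$ is a field of characteristic $p$ with $[\Bbbk:\Bbbk^p]<\infty$, $n\ge1$. Let $\mathfrak a$ be a nonzero proper ideal of $R$. Frobenius powers. For an ideal $\mathfrak b$ of $R$ and $e\ge0$, $\mathfrak b^{[p^e]}=\langle f^{p^e}:f\in\mathfrak b\rangle$, and $\mathfrak b^{[1/p^e]}$ is the smallest ideal $\mathfrak c$ with $\mathfrak b\subseteq\mathfrak c^{[p^e]}$. If $m\in\mathbb N$ has base $p$ expansion $m=m_0+m_1p+\cdots+m_rp^r$, then $\mathfrak a^{[m]}=\mathfrak a^{m_0}(\mathfrak a^{m_1})^{[p]}\cdots(\mathfrak a^{m_r})^{[p^r]}$. For $t=m/p^e$ with $m\in\mathbb N$, $\mathfrak a^{[t]}=(\mathfrak a^{[m]})^{[1/p^e]}$. For real $t\ge0$, $\mathfrak a^{[t]}=\bigcup_k\mathfrak a^{[t_k]}$, where $(t_k)$ is any sequence of rational numbers whose denominators are powers of $p$ converging to $t$ monotonically from above (the union equals $\mathfrak a^{[t_k]}$ for $k\gg0$). Test ideals. For real $t\ge0$, $\tau(\mathfrak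 a^t)=(\mathfrak a^{\lceil tp^e\rceil})^{[1/p^e]}$ for all $e\gg0$ (an increasing, eventually constant, chain in $e$); $\tau(g^t)$ means $\tau(\langle g\rangle^t)$. *)

(* Defs.v *)
From HB Require Import structures.
From mathcomp Require Import all_boot all_order all_algebra.
From mathcomp Require Import boolp classical_sets reals topology sequences.
(* The notations of normedtype clash with those of mpoly. *)
From mathcomp Require Import -(notations) normedtype.
From mathcomp Require Import mpoly.
Set Implicit Arguments.
Unset Strict Implicit.
Unset Printing Implicit Defensive.
Import Order.TTheory GRing.Theory Num.Theory numFieldNormedType.Exports.
Local Open Scope classical_set_scope.
Local Open Scope ring_scope.

(* Unlike [idealr_closed] of ring_quotient, the unit ideal is allowed here. *)
Definition is_ideal (A : comNzRingType) (I : set A) : Prop :=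
  I 0 /\ forall a f g, I f -> I g -> I (a * f + g).

Definition ideal_gen (A : comNzRingType) (S : set A) : set A :=
  smallest (@is_ideal A) S.

Definition ideal_mul (A : comNzRingType) (I J : set A) : set A :=
  ideal_gen [set f * g | f in I & g in J].

Definition ideal_pow (A : comNzRingType) (I : set A) (m : nat) : set A :=
  iter m (ideal_mul I) setT.

(* I^[p^e] *)
Definition frob (p : nat) (A : comNzRingType) (I : set A) (e : nat) : set A :=
  ideal_gen [set f ^+ (p ^ e)%N | f in I].

(* I^[1/p^e].  The smallest ideal c with I `<=` c^[p^e], when there is one, is
   the intersection of all such c: see [frob_rootE]. *)
Definition frob_root (p : nat) (A : comNzRingType) (I : set A) (e : nat) :
    set A :=
  \bigcap_(c in [set c | is_ideal c /\ I `<=` frob p c e]) c.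

Definition digit (p m i : nat) : nat := ((m %/ p ^ i) %% p)%N.

(* I^[m].  When p > 1, the digits of m of index > m are 0, so that they would
   only contribute the unit ideal to the product. *)
Definition frob_power_nat (p : nat) (A : comNzRingType) (I : set A) (m : nat) :
    set A :=
  \big[@ideal_mul A/setT]_(i < m.+1) frob p (ideal_pow I (digit p m i)) i.

(* I^[m/p^e] *)
Definition frob_power_frac (p : nat) (A : comNzRingType) (I : set A)
    (m e : nat) : set A :=
  frob_root p (frob_power_nat p I m) e.

(* The pair (m, e) stands for the rational number m/p^e. *)
Definition pfrac (p : nat) (R : realType) (q : nat * nat) : R :=
  q.1%:R / p%:R ^+ q.2.

(* "From above" is not strict: when t is itself of the form m/p^e, the sequence
   may take the value t. *)
Definition cvg_from_above (p : nat) (R : realType) (s : nat -> nat * nat)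
    (t : R) : Prop :=
  [/\ forall k, t <= pfrac p R (s k),
      nonincreasing_seq (fun k => pfrac p R (s k))
    & (fun k => pfrac p R (s k)) @ \oo --> t].

(* I^[t], computed along a sequence s with [cvg_from_above p s t]. *)
Definition frob_power_along (p : nat) (A : comNzRingType) (I : set A)
    (s : nat -> nat * nat) : set A :=
  \bigcup_k frob_power_frac p I (s k).1 (s k).2.

Definition test_ideal_approx (p : nat) (A : comNzRingType) (R : realType)
    (I : set A) (t : R) (e : nat) : set A :=
  frob_root p (ideal_pow I `|Num.ceil (t * p%:R ^+ e)|%N) e.

(* tau(I^t), the eventual value of [test_ideal_approx p I t]: see
   [test_idealE]. *)
Definition test_ideal (p : nat) (A : comNzRingType) (R : realType)
    (I : set A) (t : R) : set A :=
  [set f | \forall e \near \oo, test_ideal_approx p I t e f].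

(* [K : K^p] is finite: K is spanned over K^p by finitely many elements. *)
Definition finite_degree_over_pth_powers (p : nat) (K : fieldType) : Prop :=
  exists (m : nat) (b : 'I_m -> K),
    forall x, exists c : 'I_m -> K, x = \sum_i c i ^+ p * b i.

Lemma frob_rootE (p : nat) (A : comNzRingType) (I : set A) (e : nat)
    (c : set A) :
  is_ideal c -> I `<=` frob p c e ->
  (forall c', is_ideal c' -> I `<=` frob p c' e -> c `<=` c') ->
  frob_root p I e = c.
Proof.
move=> idc Ic minc; apply/seteqP; split=> [f|f cf c' [idc' Ic']].
  by apply; split.
exact: minc cf.
Qed.

Lemma test_idealE (p : nat) (A : comNzRingType) (R : realType)
    (I : set A) (t : R) (c : set A) :
  (\forall e \near \oo, test_ideal_approx p I t e = c) -> test_ideal p I t = c.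
Proof.
move=> H; apply/seteqP; split=> f /=.
  move=> Hf; near \oo => e.
  have <- : test_ideal_approx p I t e = c by near: e.
  by near: e.
by move=> cf; apply: filterS H => e ->.
Unshelve. all: by end_near.
Qed.

Lemma cvg_from_above_exists (p : nat) (R : realType) (t : R) :
  (1 < p)%N -> 0 <= t -> exists s, cvg_from_above p s t.
Proof.
move=> p1 t0.
have p0 : 0 < (p%:R : R) by rewrite ltr0n (ltn_trans _ p1).
have P0 e : 0 < (p%:R : R) ^+ e by rewrite exprn_gt0.
pose s (e : nat) := (`|Num.ceil (t * p%:R ^+ e)|%N, e).
have natE e : ((`|Num.ceil (t * p%:R ^+ e)|%N)%:R : R)
    = (Num.ceil (t * p%:R ^+ e))%:~R.
  rewrite -[LHS]/((`|Num.ceil (t * p%:R ^+ e)|%N : int)%:~R) gez0_abs //.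
  by rewrite ceil_ge0 (lt_le_trans _ (mulr_ge0 t0 (ltW (P0 e)))) ?oppr_lt0.
have lo e : t <= pfrac p R (s e).
  by rewrite /pfrac /= natE ler_pdivlMr // ceil_ge.
have hi e : pfrac p R (s e) <= t + (p%:R^-1) ^+ e.
  rewrite exprVn /pfrac /= natE ler_pdivrMr // mulrDl mulVf ?gt_eqF //.
  by rewrite -lerBlDr ltW // -[X in _ - X]/(1%:~R) -intrB ceilB1_lt.
exists s; split=> //.
- apply/nonincreasing_seqP => e.
  rewrite /pfrac /= !natE ler_pdivrMr // [p%:R ^+ e.+1]exprSr [leRHS]mulrA divfK ?gt_eqF //.
  rewrite -[leRHS]/(_ * (p%:Z)%:~R) -intrM ler_int ceil_le_int intrM mulrA.
  by rewrite ler_pM2r // ceil_ge.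
- have q1 : `|(p%:R^-1 : R)| < 1.
    by rewrite gtr0_norm ?invr_gt0 // invf_lt1 // ltr1n.
  apply: (@squeeze_cvgr _ _ _ _ (fun=> t) (fun e => t + (p%:R^-1) ^+ e)).
  + by apply: nearW => e; rewrite lo hi.
  + exact: cvg_cst.
  + by rewrite -[X in _ --> X]addr0; apply: cvgD; [exact: cvg_cst|exact: cvg_expr].
Qed.

(* Main.v *)
(* Let l = beta_1 x_1 + ... + beta_n x_n and let U be the set of exponents of
   l^m.  Then g^m is a combination, with nonzero coefficients, of the monomials
   x^(d u) for u in U, and d^[m] is generated by these monomials (one base p
   digit of m at a time, a power l^r with r < p contains all the monomials of
   degree r).  If m < p^e, then the vectors d u are distinct modulo p^e because
   p does not divide any d_i, so that g^m belongs to c^[p^e] if and only if each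
   x^floor(d u / p^e) belongs to c.  Hence (g^m)^[1/p^e] and (d^[m])^[1/p^e] are
   both generated by the monomials x^floor(d u / p^e).  This explicit
   description also gives the right continuity in m/p^e, and shows that the
   ideal contains d, which takes care of the terms of the sequence s that are at
   least 1. *)
Require Import Defs.
From mathcomp Require Import all_boot all_order all_algebra.
From mathcomp Require Import boolp classical_sets reals topology sequences.
(* The notations of normedtype clash with those of mpoly. *)
From mathcomp Require Import -(notations) normedtype.
From mathcomp Require Import mpoly.
Set Implicit Arguments.
Unset Strict Implicit.
Unset Printing Implicit Defensive.
Import Order.TTheory GRing.Theory Num.Theory.
Local Open Scope classical_set_scope.
Local Open Scope ring_scope.

(** * Ideals, their generators, products and powers *)

Lemma idealMl (A : comNzRingType) (I : set A) (a f : A) :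
  is_ideal I -> I f -> I (a * f).
Proof. by case=> I0 IM If; rewrite -[a * f]addr0; exact: IM. Qed.

Lemma idealD (A : comNzRingType) (I : set A) (f g : A) :
  is_ideal I -> I f -> I g -> I (f + g).
Proof. by case=> I0 IM If Ig; rewrite -[f]mul1r; exact: IM. Qed.

Lemma ideal_sum (A : comNzRingType) (I : set A) (T : Type) (r : seq T)
    (P : pred T) (F : T -> A) :
  is_ideal I -> (forall i, P i -> I (F i)) -> I (\sum_(i <- r | P i) F i).
Proof.
move=> idI IF; elim/big_ind: _ => //; first by case: idI.
by move=> f g; exact: idealD.
Qed.

Lemma ideal_bigcap (A : comNzRingType) (C : set (set A)) :
  (forall c, C c -> is_ideal c) -> is_ideal (\bigcap_(c in C) c).
Proof.
move=> idC; split=> [c /idC[]//|a f g If Ig c Cc].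
by case: (idC c Cc) => _; apply; [exact: If|exact: Ig].
Qed.

Lemma ideal_gen_ideal (A : comNzRingType) (S : set A) : is_ideal (ideal_gen S).
Proof. by apply: ideal_bigcap => c []. Qed.

Lemma sub_ideal_gen (A : comNzRingType) (S : set A) : S `<=` ideal_gen S.
Proof. exact: sub_gen_smallest. Qed.

Lemma ideal_gen_sub (A : comNzRingType) (S I : set A) :
  is_ideal I -> S `<=` I -> ideal_gen S `<=` I.
Proof. exact: smallest_sub. Qed.

Lemma ideal_mul_ideal (A : comNzRingType) (I J : set A) :
  is_ideal (ideal_mul I J).
Proof. exact: ideal_gen_ideal. Qed.

Lemma ideal_mulM (A : comNzRingType) (I J : set A) (f g : A) :
  I f -> J g -> ideal_mul I J (f * g).
Proof. by move=> If Jg; apply: sub_ideal_gen; exists f => //; exists g. Qed.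

Lemma ideal_mul_subl (A : comNzRingType) (I J : set A) :
  is_ideal I -> ideal_mul I J `<=` I.
Proof.
move=> idI; apply: ideal_gen_sub => // _ [f If [g _ <-]].
by rewrite mulrC; exact: idealMl.
Qed.

Lemma ideal_mul_subr (A : comNzRingType) (I J : set A) :
  is_ideal J -> ideal_mul I J `<=` J.
Proof.
by move=> idJ; apply: ideal_gen_sub => // _ [f _ [g Jg <-]]; exact: idealMl.
Qed.

Lemma ideal_mul_gen_sub (A : comNzRingType) (I J S T C : set A) :
  is_ideal C -> I `<=` ideal_gen S -> J `<=` ideal_gen T ->
  (forall f g, S f -> T g -> C (f * g)) -> ideal_mul I J `<=` C.
Proof.
move=> idC IS JT STC; apply: ideal_gen_sub => // _ [f /IS Sf [g /JT Tg <-]].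
(* The elements that multiply a fixed [x] into [C] form an ideal, so each factor in turn can be
   reduced to generators. *)
have idq (x : A) : is_ideal [set y | C (y * x)].
  split=> [|a u v /= Cu Cv]; first by rewrite /= mul0r; case: idC.
  by rewrite mulrDl -mulrA; case: idC => _; exact.
move: f Sf; apply: ideal_gen_sub; first exact: idq.
move=> f Sf /=; rewrite mulrC.
move: g Tg; apply: ideal_gen_sub; first exact: idq.
by move=> g Tg /=; rewrite mulrC; exact: STC.
Qed.

Lemma ideal_setT (A : comNzRingType) : is_ideal [set: A].
Proof. by []. Qed.

Lemma ideal_pow_ideal (A : comNzRingType) (I : set A) (m : nat) :
  is_ideal (ideal_pow I m).
Proof. by case: m => [|m]; [exact: ideal_setT|exact: ideal_mul_ideal]. Qed.

Lemma ideal_powX (A : comNzRingType) (I : set A) (f : A) (m : nat) :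
  I f -> ideal_pow I m (f ^+ m).
Proof.
by move=> If; elim: m => [//|m IHm]; rewrite exprS; exact: ideal_mulM.
Qed.

Lemma ideal_pow_sub (A : comNzRingType) (I : set A) (m : nat) :
  is_ideal I -> (0 < m)%N -> ideal_pow I m `<=` I.
Proof. by case: m => [//|m] idI _; exact: ideal_mul_subl. Qed.

Lemma ideal_pow_gen1 (A : comNzRingType) (g : A) (m : nat) :
  ideal_pow (ideal_gen [set g]) m = ideal_gen [set g ^+ m].
Proof.
apply/seteqP; split; last first.
  apply: ideal_gen_sub; first exact: ideal_pow_ideal.
  by move=> _ ->; apply: ideal_powX; exact: sub_ideal_gen.
elim: m => [f _|m IHm].
  rewrite -[f]mulr1; apply: (@idealMl _ (ideal_gen [set g ^+ 0])).
    exact: ideal_gen_ideal.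
  exact: sub_ideal_gen.
apply: (ideal_mul_gen_sub _ (@subset_refl _ _) IHm); first exact: ideal_gen_ideal.
by move=> _ _ -> ->; apply: sub_ideal_gen; rewrite /= exprS.
Qed.

(** * Frobenius powers and Frobenius roots of ideals *)

Lemma frob_ideal (p : nat) (A : comNzRingType) (I : set A) (e : nat) :
  is_ideal (frob p I e).
Proof. exact: ideal_gen_ideal. Qed.

Lemma frobX (p : nat) (A : comNzRingType) (I : set A) (e : nat) (f : A) :
  I f -> frob p I e (f ^+ (p ^ e)).
Proof. by move=> If; apply: sub_ideal_gen; exists f. Qed.

Lemma frob_mono (p : nat) (A : comNzRingType) (I J : set A) (e : nat) :
  I `<=` J -> frob p I e `<=` frob p J e.
Proof.
move=> IJ; apply: ideal_gen_sub; first exact: frob_ideal.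
by move=> _ [f /IJ Jf <-]; exact: frobX.
Qed.

Lemma frob_le (p : nat) (A : comNzRingType) (I : set A) (e e' : nat) :
  is_ideal I -> (0 < p)%N -> (e <= e')%N -> frob p I e' `<=` frob p I e.
Proof.
move=> idI p0 lee; apply: ideal_gen_sub; first exact: frob_ideal.
move=> _ [f If <-]; rewrite -(subnK lee) expnD exprM; apply: frobX.
have [k ->] : exists k, (p ^ (e' - e))%N = k.+1.
  by exists (p ^ (e' - e)).-1; rewrite prednK// expn_gt0 p0.
by rewrite exprSr; exact: idealMl.
Qed.

Lemma exprp_sum (p : nat) (A : comNzRingType) (e : nat) (T : Type) (r : seq T)
    (P : pred T) (F : T -> A) :
  p \in [pchar A] ->
  (\sum_(i <- r | P i) F i) ^+ (p ^ e) = \sum_(i <- r | P i) F i ^+ (p ^ e).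
Proof.
move=> pA; have p_pr := pcharf_prime pA.
apply: (big_morph (fun x : A => x ^+ (p ^ e))) => [x y|].
  by apply: exprDn_pchar; rewrite pnatX (eq_pnat _ (pcharf_eq pA)) pnat_id.
by rewrite expr0n expn_eq0 -leqn0 leqNgt prime_gt0.
Qed.

Lemma exprpD (p : nat) (A : comNzRingType) (e : nat) (x y : A) :
  p \in [pchar A] -> (x + y) ^+ (p ^ e) = x ^+ (p ^ e) + y ^+ (p ^ e).
Proof.
move=> pA; have := @exprp_sum p A e _ [:: x; y] xpredT id pA.
by rewrite !big_cons !big_nil !addr0.
Qed.

(** In characteristic p the p^e-th power map is a ring endomorphism. Closure under it can therefore
    be tested on generators of an ideal, which is how [frobD] and [frob_gen_sub] use this. *)
Lemma ideal_exprp_preim (p : nat) (A : comNzRingType) (I : set A) (e : nat) :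
  p \in [pchar A] -> is_ideal I -> is_ideal [set f | I (f ^+ (p ^ e))].
Proof.
move=> pA idI; split=> [|a f g /= If Ig].
  rewrite /= expr0n expn_eq0 -leqn0 leqNgt prime_gt0 ?(pcharf_prime pA)//.
  by case: idI.
by rewrite exprpD// exprMn; case: idI => _; exact.
Qed.

Lemma frobD (p : nat) (A : comNzRingType) (I : set A) (e k : nat) (f : A) :
  p \in [pchar A] -> frob p I e f -> frob p I (e + k) (f ^+ (p ^ k)).
Proof.
move=> pA; move: f; apply: ideal_gen_sub.
  exact/ideal_exprp_preim/frob_ideal.
by move=> _ [f If <-] /=; rewrite -exprM -expnD; exact: frobX.
Qed.

Lemma frob_gen_sub (p : nat) (A : comNzRingType) (I S C : set A) (e : nat) :
  p \in [pchar A] -> is_ideal C -> I `<=` ideal_gen S ->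
  (forall f, S f -> C (f ^+ (p ^ e))) -> frob p I e `<=` C.
Proof.
move=> pA idC IS SC; apply: ideal_gen_sub => // _ [f /IS Sf <-].
by move: f Sf; apply: ideal_gen_sub => //; exact: ideal_exprp_preim.
Qed.

Lemma frob_root_ideal (p : nat) (A : comNzRingType) (I : set A) (e : nat) :
  is_ideal (frob_root p I e).
Proof. by apply: ideal_bigcap => c []. Qed.

Lemma frob_root_sub (p : nat) (A : comNzRingType) (I c : set A) (e : nat) :
  is_ideal c -> I `<=` frob p c e -> frob_root p I e `<=` c.
Proof. by move=> idc Ic f; apply; split. Qed.

Lemma frob_root_mono (p : nat) (A : comNzRingType) (I J : set A) (e : nat) :
  I `<=` J -> frob_root p I e `<=` frob_root p J e.
Proof. by move=> IJ f If c [idc Jc]; apply: If; split=> // g /IJ /Jc. Qed.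

(** * Products over base p digits and the integral Frobenius powers *)

Lemma big_ideal_mul_ideal (A : comNzRingType) (T : Type) (r : seq T)
    (F : T -> set A) : is_ideal (\big[@ideal_mul A/setT]_(i <- r) F i).
Proof.
case: r => [|i r]; first by rewrite big_nil; exact: ideal_setT.
by rewrite big_cons; exact: ideal_mul_ideal.
Qed.

Lemma big_ideal_mul_sub (A : comNzRingType) (T : eqType) (r : seq T)
    (F : T -> set A) (i : T) :
  (forall j, is_ideal (F j)) -> i \in r ->
  \big[@ideal_mul A/setT]_(j <- r) F j `<=` F i.
Proof.
move=> idF; elim: r => [//|j r IHr]; rewrite inE big_cons => /predU1P[->|/IHr].
  exact: ideal_mul_subl.
by apply: subset_trans; apply: ideal_mul_subr; exact: big_ideal_mul_ideal.
Qed.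

Lemma big_ideal_mul_prod (A : comNzRingType) (T : Type) (r : seq T)
    (F : T -> set A) (f : T -> A) :
  (forall i, F i (f i)) ->
  (\big[@ideal_mul A/setT]_(i <- r) F i) (\prod_(i <- r) f i).
Proof.
by move=> Ff; elim/big_rec2: _ => // i x I _ Ix; exact: ideal_mulM.
Qed.

Lemma sum_digits (p N m : nat) :
  (1 < p)%N -> (m < p ^ N)%N -> (\sum_(i < N) digit p m i * p ^ i)%N = m.
Proof.
move=> p1; elim: N m => [|N IHN] m; first by case: m => // _; rewrite big_ord0.
rewrite big_ord_recl /= {1}/digit divn1 muln1 => mlt.
rewrite [RHS](divn_eq m p) addnC; congr (_ + _)%N.
rewrite -[in RHS](IHN (m %/ p)%N) ?ltn_divLR ?(ltnW p1) -?expnSr//.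
rewrite big_distrl; apply: eq_bigr => i _ /=.
by rewrite /digit /= /bump add1n -divnMA -expnS -[in RHS]mulnA -expnSr.
Qed.

(** Splitting m into its base p digits m_i writes f^m as the product of the (f^(m_i))^(p^i), one
    element from each factor of the ideal. *)
Lemma frob_power_natX (p : nat) (A : comNzRingType) (I : set A) (m : nat)
    (f : A) : (1 < p)%N -> I f -> frob_power_nat p I m (f ^+ m).
Proof.
move=> p1 If.
rewrite -[X in f ^+ X](sum_digits p1 (ltnW (ltn_expl _ p1) : (m < p ^ m.+1)%N)).
rewrite expr_sum; apply: big_ideal_mul_prod => i; rewrite exprM.
by apply: frobX; exact: ideal_powX.
Qed.

(** The factor of the leading digit suffices: that digit is nonzero and has index r >= e, so this
    factor lies in I^[p^r], hence in I^[p^e]. *)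
Lemma frob_power_nat_ge (p : nat) (A : comNzRingType) (I : set A) (m e : nat) :
  (1 < p)%N -> is_ideal I -> (p ^ e <= m)%N ->
  frob_power_nat p I m `<=` frob p I e.
Proof.
move=> p1 idI lem; have m0 : (0 < m)%N.
  by apply: leq_trans lem; rewrite expn_gt0 (ltnW p1).
have /andP[lo hi] := trunc_log_bounds p1 m0; set r := trunc_log p m in lo hi.
have rm : (r < m.+1)%N by apply: leq_trans (ltn_expl r p1) (leqW lo).
apply: subset_trans.
  apply: (@big_ideal_mul_sub _ _ _ _ (Ordinal rm)); last exact: mem_index_enum.
  by move=> j; exact: frob_ideal.
have er : (e <= r)%N.
  by rewrite -ltnS -(ltn_exp2l _ _ p1); exact: leq_ltn_trans hi.
apply: subset_trans (frob_le idI (ltnW p1) er) => /=.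
apply: frob_mono; apply: ideal_pow_sub => //.
have P0 : (0 < p ^ r)%N by rewrite expn_gt0 (ltnW p1).
by rewrite /digit modn_small ?divn_gt0// ltn_divLR// -expnS.
Qed.

(** * Division of exponent vectors with remainder *)

Definition mnm_div (n : nat) (w : 'X_{1..n}) (q : nat) : 'X_{1..n} :=
  [multinom (w i %/ q)%N | i < n].

Definition mnm_mod (n : nat) (w : 'X_{1..n}) (q : nat) : 'X_{1..n} :=
  [multinom (w i %% q)%N | i < n].

Definition mnm_scale (n : nat) (d : 'I_n -> nat) (u : 'X_{1..n}) :
    'X_{1..n} :=
  [multinom (d i * u i)%N | i < n].

Lemma mnm_divn_eq (n : nat) (w : 'X_{1..n}) (q : nat) :
  w = (mnm_div w q *+ q + mnm_mod w q)%MM.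
Proof. by apply/mnmP => i; rewrite mnmDE mulmnE !mnmE -divn_eq. Qed.

Lemma mnm_divmod_inj (n q : nat) (v v' r r' : 'X_{1..n}) :
  (forall i, (r i < q)%N) -> (forall i, (r' i < q)%N) ->
  (v *+ q + r = v' *+ q + r')%MM -> v = v' /\ r = r'.
Proof.
move=> rq r'q /mnmP eqw; split; apply/mnmP => i;
  have := eqw i; rewrite !mnmDE !mulmnE => eqi;
  have q0 : (0 < q)%N by exact: leq_ltn_trans (rq i).
- have /(congr1 (divn^~ q)) := eqi.
  by rewrite !divnMDl// !divn_small// !addn0.
- have /(congr1 (modn^~ q)) := eqi.
  by rewrite !modnMDl !modn_small.
Qed.

Lemma mnm_mod_lt (n q : nat) (w : 'X_{1..n}) (i : 'I_n) :
  (0 < q)%N -> (mnm_mod w q i < q)%N.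
Proof. by move=> q0; rewrite mnmE ltn_mod. Qed.

Lemma mnm_le_mdeg (n : nat) (v : 'X_{1..n}) (i : 'I_n) : (v i <= mdeg v)%N.
Proof. by rewrite mdegE (bigD1 i)//= leq_addr. Qed.

(** * Coefficients of elements of Frobenius powers of polynomial ideals *)

Lemma pchar_mpoly (p n : nat) (K : fieldType) :
  p \in [pchar K] -> p \in [pchar {mpoly K[n]}].
Proof. exact: (rmorph_pchar (@mpolyC n K)). Qed.

(** The p^e-th power acts on f term by term, so every exponent of the product has remainder r modulo
    p^e, and uniqueness of Euclidean division identifies the term. *)
Lemma mcoeff_mpolyXM_exprp (p n : nat) (K : fieldType) (e : nat)
    (f : {mpoly K[n]}) (r s v : 'X_{1..n}) :
  p \in [pchar K] -> (forall i, (r i < p ^ e)%N) ->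
  (forall i, (s i < p ^ e)%N) ->
  ('X_[r] * f ^+ (p ^ e))@_(v *+ (p ^ e) + s) = f@_v ^+ (p ^ e) *+ (r == s).
Proof.
move=> pK rq sq; have q0 : (0 < p ^ e)%N.
  by rewrite expn_gt0 prime_gt0 ?(pcharf_prime pK).
rewrite {1}[f]mpolyE exprp_sum ?pchar_mpoly// mulr_sumr raddf_sum /=.
under eq_bigr => u _.
  rewrite exprZn mpolyXn -scalerAr -mpolyXD mcoeffZ mcoeffX addmC.
  have -> : (u *+ (p ^ e) + r == v *+ (p ^ e) + s)%MM = (u == v) && (r == s).
    by apply/eqP/andP => [/(mnm_divmod_inj rq sq)[-> ->]|[/eqP-> /eqP->]].
  over.
rewrite /=; case: (r == s); last first.
  by rewrite big1 // => u _; rewrite andbF mulr0.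
have [vf|vf] := boolP (v \in msupp f).
  rewrite (bigD1_seq v)//= ?msupp_uniq// eqxx mulr1 big1 ?addr0// => u.
  by move/negPf->; rewrite mulr0.
rewrite (memN_msupp_eq0 vf) expr0n -leqn0 leqNgt q0 big1_seq// => u /= uf.
by case: eqP uf => [->|]; rewrite ?(negPf vf)// mulr0.
Qed.

Lemma exprpB (p : nat) (A : comNzRingType) (e : nat) (x y : A) :
  p \in [pchar A] -> (x - y) ^+ (p ^ e) = x ^+ (p ^ e) - y ^+ (p ^ e).
Proof.
by move=> pA; apply/eqP; rewrite eq_sym subr_eq -exprpD// subrK.
Qed.

(* If f^q is a K-linear combination of q-th powers of elements of c, then f is
   in c: a linear system defined over the subfield of q-th powers and solvable
   over K is solvable over the subfield.  The elements of s are eliminated one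
   at a time. *)
Lemma exprp_combination (p n : nat) (K : fieldType) (e : nat)
    (c : set {mpoly K[n]}) (s : seq (K * {mpoly K[n]})) (f : {mpoly K[n]}) :
  p \in [pchar K] -> is_ideal c -> (forall x, x \in s -> c x.2) ->
  (forall v, f@_v ^+ (p ^ e) = \sum_(x <- s) x.1 * x.2@_v ^+ (p ^ e)) -> c f.
Proof.
move=> pK idc; have q0 : (0 < p ^ e)%N.
  by rewrite expn_gt0 prime_gt0 ?(pcharf_prime pK).
have [N] := ubnP (size s); elim: N s f => // N IHN [f _ _ fE|[k h] s f].
  suff -> : f = 0 by case: idc.
  apply/mpolyP => v; rewrite mcoeff0; have /eqP := fE v.
  by rewrite big_nil expf_eq0 q0 => /eqP.
rewrite /= ltnS => sN sc fE; have ch : c h by apply: (sc (k, h)); exact: mem_head.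
have sc' x : x \in s -> c x.2 by move=> xs; apply: sc; rewrite inE xs orbT.
have [h0|[w hw]] : h = 0 \/ exists w, h@_w != 0.
  have [->|h0] := eqVneq h 0; [by left|right].
  by exists (mlead h); rewrite -mcoeff_msupp mlead_supp.
  apply: IHN sN sc' _ => v; rewrite fE big_cons /= h0 mcoeff0 expr0n.
  by rewrite -leqn0 leqNgt q0 mulr0 add0r.
(* [T] clears the coefficient at [w] by subtracting a multiple of [h]. It kills [h] itself, which
   shortens the list, and it preserves membership in [c] both ways. *)
pose T (f : {mpoly K[n]}) := f - (f@_w / h@_w) *: h.
have TE (f' : {mpoly K[n]}) v : (T f')@_v ^+ (p ^ e) =
    f'@_v ^+ (p ^ e) - f'@_w ^+ (p ^ e) * (h@_v / h@_w) ^+ (p ^ e).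
  rewrite /T mcoeffB mcoeffZ exprpB// -exprMn mulrA.
  by rewrite [_ / _ * _]mulrAC.
have cT (f' : {mpoly K[n]}) : c f' <-> c (T f').
  split=> [cf'|cTf'].
    rewrite /T -scaleNr -mul_mpolyC addrC.
    by case: idc => _; exact.
  rewrite -[f'](subrK ((f'@_w / h@_w) *: h)) addrC -mul_mpolyC.
  by case: idc => _; apply=> //; rewrite mul_mpolyC.
apply/(cT _).2; apply: (IHN [seq (x.1, T x.2) | x <- s]); first by rewrite size_map.
  by move=> _ /mapP[x xs ->] /=; apply/(cT _).1/sc'.
move=> v; rewrite TE !fE !big_cons /= big_map /= mulrDl mulr_suml.
rewrite -mulrA -exprMn [h@_w * _]mulrC divfK// opprD addrACA subrr add0r.
rewrite -sumrB; apply: eq_bigr => x _.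
by rewrite TE mulrBr mulrA.
Qed.

(** An element of c^[p^e] is a sum of terms a f^(p^e) with f in c. Only the monomials x^b of a with
    b congruent to r contribute to the residue class r, and the quotient part of x^b is absorbed
    into f. The coefficients of a remain as scalars, since they need not be p^e-th powers in K. *)
Lemma frob_coeffs (p n : nat) (K : fieldType) (e : nat)
    (c : set {mpoly K[n]}) (h : {mpoly K[n]}) (r : 'X_{1..n}) :
  p \in [pchar K] -> is_ideal c -> (forall i, (r i < p ^ e)%N) ->
  frob p c e h ->
  exists2 s : seq (K * {mpoly K[n]}), (forall x, x \in s -> c x.2) &
    forall v, h@_(v *+ (p ^ e) + r) = \sum_(x <- s) x.1 * x.2@_v ^+ (p ^ e).
Proof.
move=> pK idc rq; have q0 : (0 < p ^ e)%N.
  by rewrite expn_gt0 prime_gt0 ?(pcharf_prime pK).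
pose P (h : {mpoly K[n]}) := exists2 s : seq (K * {mpoly K[n]}),
    (forall x, x \in s -> c x.2) &
    forall v, h@_(v *+ (p ^ e) + r) = \sum_(x <- s) x.1 * x.2@_v ^+ (p ^ e).
have PD f g : P f -> P g -> P (f + g).
  move=> [s sc sE] [s' sc' sE']; exists (s ++ s') => [x|v].
    by rewrite mem_cat => /orP[/sc|/sc'].
  by rewrite mcoeffD sE sE' big_cat.
(* Quantifying over the multiplier [a] builds closure under multiplication into the set, so that it
   is an ideal. *)
suff H : frob p c e `<=` [set f | forall a, P (a * f)].
  by move=> /H /(_ 1); rewrite mul1r.
apply: ideal_gen_sub.
  split=> [a|a f g /= Pf Pg b].
    by rewrite mulr0; exists [::] => // v; rewrite mcoeff0 big_nil.
  by rewrite mulrDr mulrA; exact: PD.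
move=> _ [f cf <-] a /=.
exists [seq (a@_b, 'X_[mnm_div b (p ^ e)] * f) |
        b <- msupp a & mnm_mod b (p ^ e) == r].
  by move=> _ /mapP[b _ ->] /=; exact: idealMl.
move=> v; rewrite big_map big_filter big_mkcond {1}[a]mpolyE mulr_suml.
rewrite raddf_sum /=; apply: eq_bigr => b _.
rewrite -scalerAl mcoeffZ [X in 'X_[X] * f ^+ _](mnm_divn_eq b (p ^ e)) mpolyXD -mulrA mulrCA.
rewrite -mpolyXn -exprMn mcoeff_mpolyXM_exprp// => [|i].
  by case: eqP => _; rewrite ?mulr0.
exact: mnm_mod_lt.
Qed.

(** Within the residue class of w, h has the single term at w. After division by its coefficient,
    the p^e-th power of the monomial x^floor(w / p^e) is a K-combination of p^e-th powers of
    elements of c, and [exprp_combination] descends this to membership in c. *)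
Lemma frob_isolated (p n : nat) (K : fieldType) (e : nat)
    (c : set {mpoly K[n]}) (h : {mpoly K[n]}) (w : 'X_{1..n}) :
  p \in [pchar K] -> is_ideal c -> frob p c e h -> w \in msupp h ->
  (forall w', w' \in msupp h -> mnm_mod w' (p ^ e) = mnm_mod w (p ^ e) ->
    w' = w) ->
  c 'X_[mnm_div w (p ^ e)].
Proof.
move=> pK idc ch wh iso; have q0 : (0 < p ^ e)%N.
  by rewrite expn_gt0 prime_gt0 ?(pcharf_prime pK).
have rq i : (mnm_mod w (p ^ e) i < p ^ e)%N by exact: mnm_mod_lt.
have [s sc sE] := frob_coeffs pK idc rq ch.
rewrite mcoeff_msupp in wh.
apply: (@exprp_combination p n K e c [seq ((h@_w)^-1 * x.1, x.2) | x <- s]) => //.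
  by move=> _ /mapP[x /sc cx ->].
move=> v; rewrite big_map /=.
under eq_bigr do rewrite -mulrA.
rewrite -mulr_sumr -sE mcoeffX; case: eqVneq => [<-|neq].
  by rewrite -mnm_divn_eq mulVf// expr1n.
rewrite expr0n -leqn0 leqNgt q0 [X in _ * X]memN_msupp_eq0 ?mulr0//.
apply/negP => /iso eqw; move/eqP: neq; apply.
have /(mnm_divmod_inj rq rq)[->//] :
    (mnm_div w (p ^ e) *+ (p ^ e) + mnm_mod w (p ^ e) =
     v *+ (p ^ e) + mnm_mod w (p ^ e))%MM.
rewrite -mnm_divn_eq eqw//; apply/mnmP => i.
by rewrite mnmE mnmDE mulmnE mnmE modnMDl modn_mod.
Qed.

Lemma frob_mpolyX (p n : nat) (K : fieldType) (e : nat)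
    (c : set {mpoly K[n]}) (w : 'X_{1..n}) :
  c 'X_[mnm_div w (p ^ e)] -> frob p c e 'X_[w].
Proof.
move=> cw; rewrite [X in 'X_[X]](mnm_divn_eq w (p ^ e)) addmC mpolyXD.
rewrite -mpolyXn; apply: (@idealMl _ (frob p c e)); first exact: frob_ideal.
exact: frobX.
Qed.

(** * Supports of powers of a linear form *)

Definition linear_form (n : nat) (K : fieldType) (beta : 'I_n -> K) :
    {mpoly K[n]} := \sum_(i < n) beta i *: 'X_i.

Lemma linear_form_homog (n : nat) (K : fieldType) (beta : 'I_n -> K)
    (m : nat) (u : 'X_{1..n}) :
  u \in msupp (linear_form beta ^+ m) -> mdeg u = m.
Proof.
have /dhomogP : linear_form beta ^+ m \is m.-homog; last by exact.
rewrite -[X in X.-homog]mul1n; apply: dhomogMn.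
by apply: rpred_sum => i _; apply: dhomogZ; rewrite dhomogX; apply/eqP/mdeg1.
Qed.

(** Write the power as (l^m)^(p^e) l^r. Exponents of l^r have degree r < p^e, hence all entries
    below p^e, so they are exactly the remainders and no two products of terms collide. *)
Lemma mcoeff_linear_form_digit (p n : nat) (K : fieldType) (beta : 'I_n -> K)
    (e m r : nat) (u v : 'X_{1..n}) :
  p \in [pchar K] -> (r < p ^ e)%N -> mdeg v = r ->
  (linear_form beta ^+ (p ^ e * m + r))@_(u *+ (p ^ e) + v) =
  (linear_form beta ^+ m)@_u ^+ (p ^ e) * (linear_form beta ^+ r)@_v.
Proof.
move=> pK rq vr; set l := linear_form beta.
rewrite addnC exprD mulnC exprM {1}[l ^+ r]mpolyE mulr_suml raddf_sum /=.
have lt_q (v' : 'X_{1..n}) : mdeg v' = r -> forall i, (v' i < p ^ e)%N.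
  by move=> v'r i; apply: leq_ltn_trans (mnm_le_mdeg _ _) _; rewrite v'r.
under eq_big_seq => v' v'l.
  rewrite -scalerAl mcoeffZ mcoeff_mpolyXM_exprp//.
  over.
all: try exact: lt_q.
  exact/lt_q/(linear_form_homog v'l).
rewrite /=; have [vl|vl] := boolP (v \in msupp (l ^+ r)).
  rewrite (bigD1_seq v)//= ?msupp_uniq// eqxx mulrC big1 ?addr0// => u'.
  by move/negPf->; rewrite mulr0.
rewrite (memN_msupp_eq0 vl) mulr0 big1_seq// => u' /= u'l.
by case: eqP u'l => [->|]; rewrite ?(negPf vl)// mulr0.
Qed.

(** Derivatives replace multinomial coefficients: the derivative of l^(r+1) in x_i is (r+1) beta_i
    l^r, and (r+1) beta_i is nonzero for r+1 < p. Induction removes one variable of v at a time. *)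
Lemma linear_form_small (p n : nat) (K : fieldType) (beta : 'I_n -> K)
    (r : nat) (v : 'X_{1..n}) :
  p \in [pchar K] -> (forall i, beta i != 0) -> (r < p)%N -> mdeg v = r ->
  v \in msupp (linear_form beta ^+ r).
Proof.
move=> pK b0; set l := linear_form beta.
have dl i : l^`M(i) = (beta i)%:MP.
  rewrite /l /linear_form raddf_sum (bigD1 i)//= big1 => [|j ji].
    rewrite mderivZ mderivX mnm1E eqxx addr0 scale1r.
    by rewrite -{1}[U_(i)%MM]addm0 addmC addmK mpolyX0 -mul_mpolyC mulr1.
  by rewrite mderivZ mderivX mnm1E (negPf ji) scale0r scaler0.
have dlX i k : (l ^+ k.+1)^`M(i) = (beta i *+ k.+1)%:MP * l ^+ k.
  elim: k => [|k IHk]; first by rewrite expr1 expr0 mulr1 dl.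
  rewrite exprS mderivM dl IHk mulrCA -exprS -mulrDl -mpolyCD.
  by rewrite [in RHS]mulrS.
elim: r v => [|r IHr] v rp vr.
  by move/eqP: vr; rewrite mdeg_eq0 => /eqP->; rewrite expr0 msupp1 inE.
have [i vi] : exists i, (0 < v i)%N.
  apply/existsP; rewrite -[X in is_true X]negbK; apply/negP => /existsPn v0.
  move: vr; rewrite mdegE big1// => i _; apply/eqP.
  by rewrite -leqn0 leqNgt v0.
have vE : v = (v - U_(i) + U_(i))%MM.
  by rewrite submK//; apply/mnm_lepP => j; rewrite mnm1E; case: eqP => [<-|].
have vr' : mdeg (v - U_(i)) = r.
  by apply/eqP; rewrite -eqSS -vr [in eqbRHS]vE mdegD mdeg1 addn1.
have := IHr _ (ltnW rp) vr'; rewrite !mcoeff_msupp.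
apply: contraNN => /eqP lv0.
have := congr1 (mcoeff (v - U_(i))%MM) (dlX i r).
rewrite mcoeff_deriv -vE lv0 mul0rn mcoeffCM => /esym/eqP.
rewrite mulf_eq0 -mulr_natr mulf_eq0 (negPf (b0 i)) /=.
by rewrite -(dvdn_pcharf pK) gtnNdvd.
Qed.

Lemma linear_form_digit (p n : nat) (K : fieldType) (beta : 'I_n -> K)
    (e m r : nat) (u v : 'X_{1..n}) :
  p \in [pchar K] -> (r < p ^ e)%N ->
  u \in msupp (linear_form beta ^+ m) -> v \in msupp (linear_form beta ^+ r) ->
  (u *+ (p ^ e) + v)%MM \in msupp (linear_form beta ^+ (p ^ e * m + r)).
Proof.
move=> pK rq ul vl; rewrite mcoeff_msupp mcoeff_linear_form_digit//.
  by rewrite mulf_neq0 ?expf_neq0 -?mcoeff_msupp.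
exact: linear_form_homog vl.
Qed.

(** Induction on the base p digits of m: the last digit is covered by [linear_form_small], the
    others by [m %/ p], and [linear_form_digit] glues them. *)
Lemma linear_form_pure (p n : nat) (K : fieldType) (beta : 'I_n -> K)
    (m : nat) (i : 'I_n) :
  p \in [pchar K] -> (forall j, beta j != 0) ->
  (U_(i) *+ m)%MM \in msupp (linear_form beta ^+ m).
Proof.
move=> pK b0; have p_pr := pcharf_prime pK.
elim/ltn_ind: m => m IHm; have [mp|pm] := ltnP m p.
  by apply: (linear_form_small pK) => //; rewrite mdegMn mdeg1 mul1n.
have lt_m : (m %/ p < m)%N.
  by rewrite ltn_Pdiv ?prime_gt1// (leq_trans _ pm) ?prime_gt0.
have rp : (m %% p < p ^ 1)%N by rewrite ltn_mod prime_gt0.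
have vl : (U_(i) *+ (m %% p))%MM \in msupp (linear_form beta ^+ (m %% p)).
  by apply: (linear_form_small pK) => //; rewrite ?ltn_mod ?prime_gt0// mdegMn mdeg1 mul1n.
have := linear_form_digit pK rp (IHm _ lt_m) vl.
rewrite expn1 mulnC -divn_eq.
suff <- : (U_(i) *+ m = U_(i) *+ (m %/ p) *+ p + U_(i) *+ (m %% p))%MM by [].
apply/mnmP => j.
by rewrite mnmDE !mulmnE -mulnA -mulnDr -divn_eq.
Qed.

(** * The diagonal polynomial and the ideal of its monomials *)

Definition diagonal_poly (n : nat) (K : fieldType) (d : 'I_n -> nat)
    (beta : 'I_n -> K) : {mpoly K[n]} := \sum_(i < n) beta i *: 'X_i ^+ d i.

Definition diagonal_ideal (n : nat) (K : fieldType) (d : 'I_n -> nat) :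
    set {mpoly K[n]} := ideal_gen (range (fun i : 'I_n => 'X_i ^+ d i)).

Definition floor_ideal (p n : nat) (K : fieldType) (d : 'I_n -> nat)
    (beta : 'I_n -> K) (m e : nat) : set {mpoly K[n]} :=
  ideal_gen [set 'X_[mnm_div (mnm_scale d u) (p ^ e)]
            | u in [set` msupp (linear_form beta ^+ m)]].

Lemma mpolyX_scale (n : nat) (K : fieldType) (d : 'I_n -> nat)
    (u : 'X_{1..n}) :
  'X_[mnm_scale d u] = \prod_(i < n) ('X_i ^+ d i) ^+ u i :> {mpoly K[n]}.
Proof.
by rewrite mpolyXE_id; apply: eq_bigr => i _; rewrite mnmE exprM.
Qed.

Lemma mnm_scaleU (n : nat) (d : 'I_n -> nat) (i : 'I_n) :
  mnm_scale d U_(i) = (U_(i) *+ d i)%MM.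
Proof.
by apply/mnmP => j; rewrite mnmE mulmnE mnm1E mulnC; case: eqP => [->|].
Qed.

Lemma mnm_scaleD (n : nat) (d : 'I_n -> nat) (u v : 'X_{1..n}) :
  mnm_scale d (u + v)%MM = (mnm_scale d u + mnm_scale d v)%MM.
Proof. by apply/mnmP => j; rewrite mnmE !mnmDE !mnmE mulnDr. Qed.

Lemma mnm_scaleMn (n : nat) (d : 'I_n -> nat) (u : 'X_{1..n}) (k : nat) :
  mnm_scale d (u *+ k)%MM = (mnm_scale d u *+ k)%MM.
Proof. by apply/mnmP => j; rewrite mnmE !mulmnE mnmE mulnA. Qed.

Lemma mnm_scale_inj (n : nat) (d : 'I_n -> nat) :
  (forall i, (0 < d i)%N) -> injective (@mnm_scale n d).
Proof.
move=> d0 u v /mnmP uv; apply/mnmP => i; have := uv i; rewrite !mnmE => /eqP.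
by rewrite eqn_pmul2l// => /eqP.
Qed.

(** g arises from l by the substitution of x_i^(d_i) for x_i, a ring morphism, so g^m arises from
    l^m in the same way. *)
Lemma diagonal_polyX (n : nat) (K : fieldType) (d : 'I_n -> nat)
    (beta : 'I_n -> K) (m : nat) :
  diagonal_poly d beta ^+ m =
  \sum_(u <- msupp (linear_form beta ^+ m))
     (linear_form beta ^+ m)@_u *: 'X_[mnm_scale d u].
Proof.
have -> : diagonal_poly d beta =
    linear_form beta \mPo [tuple 'X_i ^+ d i | i < n].
  rewrite raddf_sum; apply: eq_bigr => i _ /=.
  by rewrite comp_mpolyZ comp_mpolyXU -tnth_nth tnth_mktuple.
rewrite -rmorphXn /= comp_mpolyE; apply: eq_bigr => u _.
rewrite mpolyX_scale; congr (_ *: _); apply: eq_bigr => i _.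
by rewrite tnth_mktuple.
Qed.

Lemma mem_msupp_diagonal_polyX (n : nat) (K : fieldType) (d : 'I_n -> nat)
    (beta : 'I_n -> K) (m : nat) (u : 'X_{1..n}) :
  (forall i, (0 < d i)%N) -> u \in msupp (linear_form beta ^+ m) ->
  mnm_scale d u \in msupp (diagonal_poly d beta ^+ m).
Proof.
move=> d0 ul; rewrite mcoeff_msupp diagonal_polyX raddf_sum /=.
rewrite (bigD1_seq u)//= ?msupp_uniq// mcoeffZ mcoeffX eqxx mulr1.
rewrite big1 ?addr0 -?mcoeff_msupp// => v vu.
by rewrite mcoeffZ mcoeffX (inj_eq (mnm_scale_inj d0)) (negPf vu) mulr0.
Qed.

Lemma msupp_diagonal_polyXP (n : nat) (K : fieldType) (d : 'I_n -> nat)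
    (beta : 'I_n -> K) (m : nat) (w : 'X_{1..n}) :
  w \in msupp (diagonal_poly d beta ^+ m) ->
  exists2 u, u \in msupp (linear_form beta ^+ m) & w = mnm_scale d u.
Proof.
rewrite mcoeff_msupp diagonal_polyX raddf_sum /= => /eqP wg.
apply: contrapT => nex; apply: wg; rewrite big1_seq// => u /= ul.
rewrite mcoeffZ mcoeffX; case: eqP => [uw|]; last by rewrite mulr0.
by case: nex; exists u.
Qed.

(** d is invertible modulo p^e, and a, b are already reduced. *)
Lemma eq_mod_pmull (p e d a b : nat) :
  prime p -> ~~ (p %| d)%N -> (a < p ^ e)%N -> (b < p ^ e)%N ->
  (d * a = d * b %[mod p ^ e])%N -> a = b.
Proof.
move=> p_pr pd; wlog ab : a b / (a <= b)%N => [H aq bq E|aq bq /esym/eqP].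
  by case: (leqP a b) => [|/ltnW] ab; [|symmetry]; apply: H.
rewrite eqn_mod_dvd ?leq_mul2l ?ab ?orbT// -mulnBr Gauss_dvdr.
  have [ab0 _|ab0] := posnP (b - a).
    by apply/eqP; rewrite eqn_leq ab -subn_eq0 ab0 eqxx.
  by rewrite gtnNdvd// (leq_ltn_trans (leq_subr _ _)).
by rewrite coprimeXl// prime_coprime.
Qed.

(** * Floor ideals as Frobenius roots *)

Lemma floor_ideal_ideal (p n : nat) (K : fieldType) (d : 'I_n -> nat)
    (beta : 'I_n -> K) (m e : nat) : is_ideal (floor_ideal p d beta m e).
Proof. exact: ideal_gen_ideal. Qed.

Lemma floor_ideal_sub_root (p n : nat) (K : fieldType) (d : 'I_n -> nat)
    (beta : 'I_n -> K) (m e : nat) :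
  p \in [pchar K] -> (forall i, (0 < d i)%N) -> (forall i, ~~ (p %| d i)%N) ->
  (m < p ^ e)%N ->
  floor_ideal p d beta m e `<=`
  frob_root p (ideal_pow (ideal_gen [set diagonal_poly d beta]) m) e.
Proof.
move=> pK d0 pd mq; apply: ideal_gen_sub; first exact: frob_root_ideal.
move=> _ [u ul <-] c [idc gc].
apply: (frob_isolated pK idc (h := diagonal_poly d beta ^+ m)).
- by apply: gc; apply: ideal_powX; exact: sub_ideal_gen.
- exact: mem_msupp_diagonal_polyX.
- move=> w /msupp_diagonal_polyXP[v vl ->] /mnmP eqm; congr mnm_scale.
  (* Entries of an exponent of l^m are at most m < p^e, so the residue of d u modulo p^e determines
     u. *)
  have lt_q (v' : 'X_{1..n}) : v' \in msupp (linear_form beta ^+ m) ->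
      forall i, (v' i < p ^ e)%N.
    move=> /linear_form_homog v'm i; apply: leq_ltn_trans mq.
    by rewrite -v'm mnm_le_mdeg.
  apply/mnmP => i; apply: (eq_mod_pmull (pcharf_prime pK) (pd i)).
  + exact: lt_q.
  + exact: lt_q.
  + by have := eqm i; rewrite !mnmE.
Qed.

Lemma diagonal_ideal_pow (n : nat) (K : fieldType) (d : 'I_n -> nat)
    (k : nat) :
  ideal_pow (@diagonal_ideal n K d) k `<=`
  ideal_gen [set 'X_[mnm_scale d u] | u in [set u | mdeg u = k]].
Proof.
elim: k => [|k IHk].
  move=> f _; rewrite -[f]mulr1.
  apply: (@idealMl _ (ideal_gen _)); first exact: ideal_gen_ideal.
  apply: sub_ideal_gen; exists 0%MM; first exact: mdeg0.
  by rewrite mpolyX_scale big1// => i _; rewrite mnm0E expr0.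
apply: (ideal_mul_gen_sub _ (@subset_refl _ _) IHk).
  exact: ideal_gen_ideal.
move=> _ _ [i _ <-] [u uk <-]; apply: sub_ideal_gen.
exists (U_(i) + u)%MM; first by rewrite /= mdegD mdeg1 uk.
by rewrite mnm_scaleD mpolyXD mnm_scaleU mpolyXn.
Qed.

Lemma frob_power_nat_diagonal_ideal (p n : nat) (K : fieldType)
    (d : 'I_n -> nat) (beta : 'I_n -> K) (m : nat) :
  p \in [pchar K] -> (forall i, beta i != 0) ->
  frob_power_nat p (@diagonal_ideal n K d) m `<=`
  ideal_gen [set 'X_[mnm_scale d u]
            | u in [set` msupp (linear_form beta ^+ m)]].
Proof.
move=> pK b0; have p_pr := pcharf_prime pK; have p0 := prime_gt0 p_pr.
(* Generalized for induction on the number N of digits: k counts the digits already removed, which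
   twist the remaining factors by p^k. *)
suff H N k m' : (m' < p ^ N)%N ->
    \big[@ideal_mul {mpoly K[n]}/setT]_(i < N)
      frob p (ideal_pow (diagonal_ideal d) (digit p m' i)) (i + k) `<=`
    ideal_gen [set 'X_[mnm_scale d (u *+ (p ^ k))]
              | u in [set` msupp (linear_form beta ^+ m')]].
  have := H m.+1 0%N m (ltnW (ltn_expl _ (prime_gt1 p_pr))).
  under eq_bigr do rewrite addn0.
  by under [in X in _ -> X]eq_imagel do rewrite -[X in mnm_scale d X]mulm1n.
elim: N k m' => [|N IHN] k m'.
  case: m' => // _ f _; rewrite -[f]mulr1.
  apply: (@idealMl _ (ideal_gen _)); first exact: ideal_gen_ideal.
  apply: sub_ideal_gen; exists 0%MM; first by rewrite /= expr0 msupp1 inE.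
  by rewrite mpolyX_scale big1// => i _; rewrite mulmnE mnm0E expr0.
move=> m'lt; rewrite big_ord_recl /= add0n {1}/digit divn1.
have lt' : (m' %/ p < p ^ N)%N by rewrite ltn_divLR// -expnSr.
have eqF : \big[@ideal_mul {mpoly K[n]}/setT]_(i < N)
      frob p (ideal_pow (diagonal_ideal d) (digit p m' (bump 0 i)))
        (bump 0 i + k) =
    \big[@ideal_mul {mpoly K[n]}/setT]_(i < N)
      frob p (ideal_pow (diagonal_ideal d) (digit p (m' %/ p) i)) (i + k.+1).
  apply: eq_bigr => i _; rewrite /bump add1n addSnnS; congr (frob _ (ideal_pow _ _) _).
  by rewrite /digit -divnMA -expnS.
rewrite eqF {eqF}.
have r1 : frob p (ideal_pow (@diagonal_ideal n K d) (m' %% p)) k `<=`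
    ideal_gen [set 'X_[mnm_scale d (v *+ (p ^ k))]
              | v in [set v | mdeg v = (m' %% p)%N]].
  apply: (frob_gen_sub _ _ (@diagonal_ideal_pow _ _ _ _)).
  - exact: pchar_mpoly.
  - exact: ideal_gen_ideal.
  - move=> _ [v vr <-]; apply: sub_ideal_gen; exists v => //.
    by rewrite mpolyXn mnm_scaleMn.
apply: (ideal_mul_gen_sub _ r1 (IHN k.+1 _ lt')); first exact: ideal_gen_ideal.
move=> _ _ [v vr <-] [u ul <-]; apply: sub_ideal_gen.
(* [v] comes from the last digit of m' and [u] from the quotient by p; the twist of [u] by p^(k+1)
   splits as p times p^k. *)
exists (u *+ (p ^ 1) + v)%MM; last first.
  rewrite -mpolyXD -mnm_scaleD; congr ('X_[mnm_scale d _]).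
  apply/mnmP => i; rewrite !(mnmDE, mulmnE) addnC mulnDl -mulnA -expnD add1n.
  by [].
have rp : (m' %% p < p ^ 1)%N by rewrite ltn_mod.
rewrite /= [X in _ ^+ X](divn_eq m' p) mulnC -{4}[p]expn1.
apply: (linear_form_digit pK rp ul).
by apply: (linear_form_small pK) => //; rewrite ltn_mod.
Qed.

(** A cycle of inclusions: the floor ideal lies in (g^m)^[1/p^e] by isolated exponents, this lies in
    d^[m/p^e] because g^m is in d^[m], and the monomial generators of d^[m] bring d^[m/p^e] back
    into the floor ideal. *)
Lemma floor_idealE (p n : nat) (K : fieldType) (d : 'I_n -> nat)
    (beta : 'I_n -> K) (m e : nat) :
  p \in [pchar K] -> (forall i, (0 < d i)%N) -> (forall i, beta i != 0) ->
  (forall i, ~~ (p %| d i)%N) -> (m < p ^ e)%N ->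
  frob_root p (ideal_pow (ideal_gen [set diagonal_poly d beta]) m) e =
    floor_ideal p d beta m e /\
  frob_power_frac p (diagonal_ideal d) m e = floor_ideal p d beta m e.
Proof.
move=> pK d0 b0 pd mq; have p1 := prime_gt1 (pcharf_prime pK).
have MJ := floor_ideal_sub_root (beta := beta) pK d0 pd mq.
have JF : frob_root p (ideal_pow (ideal_gen [set diagonal_poly d beta]) m) e
    `<=` frob_power_frac p (diagonal_ideal d) m e.
  apply: frob_root_mono; rewrite ideal_pow_gen1.
  apply: ideal_gen_sub; first exact: big_ideal_mul_ideal.
  move=> _ ->; apply: frob_power_natX => //.
  apply: ideal_sum => [|i _]; first exact: ideal_gen_ideal.
  rewrite -mul_mpolyC; apply: (@idealMl _ (diagonal_ideal d)).
    exact: ideal_gen_ideal.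
  by apply: sub_ideal_gen; exists i.
have FM : frob_power_frac p (diagonal_ideal d) m e `<=`
    floor_ideal p d beta m e.
  apply: frob_root_sub; first exact: floor_ideal_ideal.
  apply: subset_trans (frob_power_nat_diagonal_ideal pK b0) _.
  apply: ideal_gen_sub; first exact: frob_ideal.
  move=> _ [u ul <-]; apply: frob_mpolyX; apply: sub_ideal_gen.
  by exists u.
by split; apply/seteqP; split=> // f; [move/JF/FM|move/MJ/JF].
Qed.

(** * Dependence of floor ideals on the exponent m/p^e *)

(** One inclusion uses the description as a root: if g^m is in c^[p^e], its p^a-th power is in
    c^[p^(e+a)]. The other uses generators: p^a u is an exponent of l^(p^a m) and gives the same
    floors as u. *)
Lemma floor_ideal_expand (p n : nat) (K : fieldType) (d : 'I_n -> nat)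
    (beta : 'I_n -> K) (m e a : nat) :
  p \in [pchar K] -> (forall i, (0 < d i)%N) -> (forall i, beta i != 0) ->
  (forall i, ~~ (p %| d i)%N) -> (m < p ^ e)%N ->
  floor_ideal p d beta (p ^ a * m) (e + a) = floor_ideal p d beta m e.
Proof.
move=> pK d0 b0 pd mq; have p0 := prime_gt0 (pcharf_prime pK).
have mq' : (p ^ a * m < p ^ (e + a))%N.
  by rewrite expnD mulnC ltn_pmul2r// expn_gt0 p0.
apply/seteqP; split.
  rewrite -(floor_idealE pK d0 b0 pd mq).1 -(floor_idealE pK d0 b0 pd mq').1.
  move=> f Jf c [idc gc]; apply: Jf; split=> //.
  rewrite ideal_pow_gen1; apply: ideal_gen_sub; first exact: frob_ideal.
  move=> _ ->; rewrite mulnC exprM; apply: frobD; first exact: pchar_mpoly.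
  by apply: gc; apply: ideal_powX; exact: sub_ideal_gen.
apply: ideal_gen_sub; first exact: floor_ideal_ideal.
move=> _ [u ul <-]; apply: sub_ideal_gen; exists (u *+ (p ^ a))%MM.
  rewrite -[(u *+ _)%MM]addm0 -[(p ^ a * m)%N]addn0.
  apply: (linear_form_digit pK) => //; first by rewrite expn_gt0 p0.
  by rewrite expr0 msupp1 inE.
congr 'X_[_]; apply/mnmP => i; rewrite !mnmE mulmnE mulnA expnD divnMr//.
by rewrite expn_gt0 p0.
Qed.

(** Over the common denominator p^(e+e'), the larger power of g is a multiple of the smaller one. *)
Lemma floor_ideal_le (p n : nat) (K : fieldType) (d : 'I_n -> nat)
    (beta : 'I_n -> K) (m e m' e' : nat) :
  p \in [pchar K] -> (forall i, (0 < d i)%N) -> (forall i, beta i != 0) ->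
  (forall i, ~~ (p %| d i)%N) -> (m < p ^ e)%N -> (m' < p ^ e')%N ->
  (m * p ^ e' <= m' * p ^ e)%N ->
  floor_ideal p d beta m' e' `<=` floor_ideal p d beta m e.
Proof.
move=> pK d0 b0 pd mq mq' lem; have p0 := prime_gt0 (pcharf_prime pK).
rewrite -(floor_ideal_expand e' pK d0 b0 pd mq).
rewrite -(floor_ideal_expand e pK d0 b0 pd mq') addnC.
have P0 k : (0 < p ^ k)%N by rewrite expn_gt0 p0.
have lt1 : (p ^ e' * m < p ^ (e + e'))%N by rewrite expnD mulnC ltn_pmul2r.
have lt2 : (p ^ e * m' < p ^ (e + e'))%N by rewrite expnD ltn_pmul2l.
rewrite -(floor_idealE pK d0 b0 pd lt1).1 -(floor_idealE pK d0 b0 pd lt2).1.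
apply: frob_root_mono; rewrite !ideal_pow_gen1.
apply: ideal_gen_sub; first exact: ideal_gen_ideal.
move=> _ ->; rewrite -(subnK (_ : (p ^ e' * m <= p ^ e * m')%N)); last first.
  by rewrite ![(p ^ _ * _)%N]mulnC.
rewrite exprD; apply: (@idealMl _ (ideal_gen _)); first exact: ideal_gen_ideal.
exact: sub_ideal_gen.
Qed.

(* The exponent (p^a m + 1)/p^(e+a) exceeds m/p^e by so little that no floor
   changes: this is the right continuity of the test ideals of g. *)
Lemma floor_ideal_right (p n : nat) (K : fieldType) (d : 'I_n -> nat)
    (beta : 'I_n -> K) (m e a : nat) (i : 'I_n) :
  p \in [pchar K] -> (forall j, beta j != 0) -> (0 < a)%N ->
  (d i < p ^ a)%N ->
  floor_ideal p d beta m e `<=`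
  floor_ideal p d beta (p ^ a * m + 1) (e + a).
Proof.
move=> pK b0 a0 da; have p1 := prime_gt1 (pcharf_prime pK).
have p0 := ltnW p1; have P0 k : (0 < p ^ k)%N by rewrite expn_gt0 p0.
apply: ideal_gen_sub; first exact: floor_ideal_ideal.
move=> _ [u ul <-]; apply: sub_ideal_gen; exists (u *+ (p ^ a) + U_(i))%MM.
  have q1 : (1 < p ^ a)%N by rewrite -(expn0 p) ltn_exp2l.
  apply: (linear_form_digit pK q1 ul).
  by rewrite -[U_(i)%MM]mulm1n; exact: (linear_form_pure _ _ pK).
congr 'X_[_]; apply/mnmP => j; rewrite !mnmE !(mnmDE, mulmnE) mulnDr.
(* Dividing by p^a first discards the extra summand, which is d i or 0 and thus less than p^a. *)
rewrite expnD divnMA divnAC mulnA divnMDl// [X in (_ + X)%N]divn_small ?addn0//.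
by case: (i =P j) => [<-|_]; rewrite ?muln1 ?muln0.
Qed.

Lemma diagonal_ideal_sub_floor (p n : nat) (K : fieldType) (d : 'I_n -> nat)
    (beta : 'I_n -> K) (m e : nat) :
  p \in [pchar K] -> (forall j, beta j != 0) -> (m < p ^ e)%N ->
  diagonal_ideal d `<=` floor_ideal p d beta m e.
Proof.
move=> pK b0 mq; have p0 := prime_gt0 (pcharf_prime pK).
have P0 : (0 < p ^ e)%N by rewrite expn_gt0 p0.
apply: ideal_gen_sub; first exact: floor_ideal_ideal.
(* The exponent m U_(i) of l^m yields the generator x_i^k, and k <= d i because m < p^e. *)
move=> _ [i _ <-]; set k := (d i * m %/ p ^ e)%N.
have kd : (k <= d i)%N.
  by rewrite -(mulnK (d i) P0) leq_div2r// leq_mul2l (ltnW mq) orbT.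
rewrite -(subnK kd) exprD.
apply: (@idealMl _ (floor_ideal p d beta m e)); first exact: floor_ideal_ideal.
apply: sub_ideal_gen; exists (U_(i) *+ m)%MM; first exact: (linear_form_pure _ _ pK).
rewrite mpolyXn; congr 'X_[_]; apply/mnmP => j.
rewrite !mnmE !mulmnE mnm1E; case: eqP => [<-|_]; first by rewrite !mul1n.
by rewrite !mul0n muln0 div0n.
Qed.

Lemma frob_power_frac_ge1 (p : nat) (A : comNzRingType) (I : set A)
    (m e : nat) :
  (1 < p)%N -> is_ideal I -> (p ^ e <= m)%N -> frob_power_frac p I m e `<=` I.
Proof.
move=> p1 idI lem; apply: frob_root_sub => //.
exact: frob_power_nat_ge.
Qed.

(** * Passage to real exponents *)

Lemma natr_ceil (R : realType) (x : R) :
  0 <= x -> (`|Num.ceil x|%N)%:R = (Num.ceil x)%:~R :> R.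
Proof.
move=> x0; rewrite -[LHS]/((`|Num.ceil x|%N : int)%:~R) gez0_abs//.
by rewrite ceil_ge0 (lt_le_trans _ x0)// oppr_lt0.
Qed.

Lemma absz_ceil_le (R : realType) (x : R) (m : nat) :
  0 <= x -> (`|Num.ceil x| <= m)%N = (x <= m%:R).
Proof.
move=> x0; rewrite -(ler_nat R) natr_ceil//.
by rewrite -[m%:R]/((m%:Z)%:~R) ler_int ceil_le_int.
Qed.

Theorem proposition6p2 (p : nat) (K : fieldType) (R : realType) (n : nat)
    (d : 'I_n -> nat) (beta : 'I_n -> K) (t : R) (s : nat -> nat * nat)
    (pcharKp : p \in [pchar K])
    (Kfin : finite_degree_over_pth_powers p K)
    (n_gt0 : (0 < n)%N)
    (d_gt0 : forall i, (0 < d i)%N)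
    (beta_neq0 : forall i, beta i != 0)
    (p_ndvd_d : forall i, ~~ (p %| d i)%N)
    (t_gt0 : 0 < t) (t_lt1 : t < 1)
    (s_cvg : cvg_from_above p s t) :
  let g : {mpoly K[n]} := \sum_(i < n) beta i *: 'X_i ^+ d i in
  let D : set {mpoly K[n]} := ideal_gen (range (fun i : 'I_n => 'X_i ^+ d i)) in
  test_ideal p (ideal_gen [set g]) t = frob_power_along p D s.
Proof.
move=> g D; have p1 := prime_gt1 (pcharf_prime pcharKp); have p0 := ltnW p1.
have P0 k : (0 < p ^ k)%N by rewrite expn_gt0 p0.
have PR0 k : 0 < p%:R ^+ k :> R by rewrite -natrX ltr0n.
have tq0 k : 0 <= t * p%:R ^+ k by rewrite mulr_ge0 ?ltW.
(* [c e] is the least numerator over p^e of a fraction at least t. *)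
pose c e := `|Num.ceil (t * p%:R ^+ e)|%N.
have c_le e m : (c e <= m)%N = (t * p%:R ^+ e <= m%:R) by exact: absz_ceil_le.
have c_expand e a : (c (e + a) <= p ^ a * c e)%N.
  rewrite c_le exprD mulrA mulnC natrM natrX ler_pM2r//.
  by rewrite -c_le.
have fE m e := floor_idealE (m := m) (e := e) pcharKp d_gt0 beta_neq0 p_ndvd_d.
have fle m e m' e' := floor_ideal_le (m := m) (e := e) (m' := m') (e' := e')
  pcharKp d_gt0 beta_neq0 p_ndvd_d.
(* Once a fraction m/p^e lies in [t, 1), every later approximation c e' / p^e' is below 1 and at
   most m/p^e. *)
have c_persist e m : (c e <= m)%N -> (m < p ^ e)%N ->
    forall e', (e <= e')%N -> (c e' < p ^ e')%N /\ (c e' * p ^ e <= m * p ^ e')%N.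
  move=> cm mq e' /subnKC <-; have H := c_expand e (e' - e)%N.
  split; first by rewrite (leq_ltn_trans H)// expnD mulnC ltn_pmul2r// (leq_ltn_trans cm).
  by rewrite expnD mulnCA [(c _ * _)%N]mulnC leq_pmul2l// (leq_trans H)// mulnC leq_pmul2r.
have [s_ge s_dec s_lim] := s_cvg.
have c_s k : (c (s k).2 <= (s k).1)%N.
  by rewrite c_le -ler_pdivlMr//; exact: s_ge.
have s_lt m e : t < m%:R / p%:R ^+ e ->
    exists k, ((s k).1 * p ^ e < m * p ^ (s k).2)%N.
  move=> tm; have : \forall k \near \oo, pfrac p R (s k) < m%:R / p%:R ^+ e.
    exact: (cvgr_lt t).
  move=> [k _ /(_ k (leqnn k))] /=; rewrite /pfrac ltr_pdivrMr// mulrAC.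
  by rewrite ltr_pdivlMr// -!natrX -!natrM ltr_nat; exists k.
(* As t < 1 = 1/p^0, some term of the sequence is below 1; from its level on, [floor_idealE] applies
   to every approximation. *)
have [k0 k0lt] : exists k, ((s k).1 < p ^ (s k).2)%N.
  have [|k] := s_lt 1%N 0%N; first by rewrite expr0 divr1.
  by rewrite expn0 muln1 mul1n => H; exists k.
have c_lt := c_persist _ _ (c_s k0) k0lt.
apply/seteqP; split=> f.
  (* At this level f lies in the floor ideal of c e / p^e. Right continuity moves f to an exponent
     strictly above t; some term of the sequence falls below that exponent, and smaller exponents
     have larger ideals. *)
  move=> [e1 _ He1]; pose e := maxn e1 (s k0).2.
  have /He1 : (e1 <= e)%N by exact: leq_maxl.
  have [ce _] := c_lt e (leq_maxr _ _).
  rewrite /= /test_ideal_approx -/(c e) (fE _ _ ce).1 => fM.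
  (* Any variable would do; [a := d i] makes p^a exceed d i. *)
  pose i := Ordinal n_gt0; pose a := d i.
  have da : (d i < p ^ a)%N by exact: ltn_expl.
  have a0 : (0 < a)%N by exact: d_gt0.
  have {}fM := floor_ideal_right pcharKp beta_neq0 a0 da fM.
  (* Since 1 < p^a, the left side is below p^a (c e + 1), and c e + 1 <= p^e. *)
  have mlt : (p ^ a * c e + 1 < p ^ (e + a))%N.
    have q1 : (1 < p ^ a)%N by rewrite -(expn0 p) ltn_exp2l.
    rewrite expnD; apply: (@leq_trans (p ^ a * c e + p ^ a)).
      by rewrite ltn_add2l.
    by rewrite addnC -mulnS mulnC leq_pmul2r.
  have [k klt] : exists k,
      ((s k).1 * p ^ (e + a) < (p ^ a * c e + 1) * p ^ (s k).2)%N.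
    apply: s_lt; rewrite ltr_pdivlMr// natrD natrM natrX exprD mulrA.
    rewrite [ltRHS]addrC mulrC ltr_pwDl// ler_pM2l//.
    by rewrite -c_le.
  have klt1 : ((s k).1 < p ^ (s k).2)%N.
    rewrite -(ltn_pmul2r (P0 (e + a)%N)) (ltn_trans klt)// mulnC.
    by rewrite ltn_pmul2l.
  exists k => //; rewrite (fE _ _ klt1).2.
  by apply: fle fM => //; exact: ltnW.
(* If the term is below 1, all approximations from its level on have exponents at most that term,
   hence larger ideals. If it is at least 1, its ideal lies in [D], which every floor ideal with m <
   p^e contains. *)
move=> [k _ fk]; have [klt|kge] := ltnP (s k).1 (p ^ (s k).2).
  rewrite (fE _ _ klt).2 in fk; exists (s k).2 => // e /= le_e.
  have [ce cle] := c_persist _ _ (c_s k) klt e le_e.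
  by rewrite /test_ideal_approx -/(c e) (fE _ _ ce).1; exact: fle fk.
have idD : is_ideal D by exact: ideal_gen_ideal.
exists (s k0).2 => // e /= le_e; have [ce _] := c_lt e le_e.
rewrite /test_ideal_approx -/(c e) (fE _ _ ce).1.
apply: diagonal_ideal_sub_floor => //.
exact: frob_power_frac_ge1 fk.
Qed.
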